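(* In the setting described in the context, for each $h>0$ there exists $\alpha_{\mathrm{MQ}}(h)>0$ such that \[ \inf_{q_h\in Q_L\setminus\{0\}}\ \sup_{v_h\in V_h\setminus\{0\}}\frac{(v_h,q_h)_{0,I}}{\|v_h\|_{0,I}\,\|q_h\|_{0,I}}\ge\alpha_{\mathrm{MQ}}(h). \]
   Context: Let $I$ be a bounded interval and $(\cdot,\cdot)_{0,I}$, $\|\cdot\|_{0,I}$ the $L^2(I)$ inner product and norm. Let $\mathcal T_h$ be a uniform mesh of $I$ with mesh size $h$, and let $\mathcal S^p(\mathcal T_h)$ denote the univariate B-spline space of degree $p\ge2$ on the open knot vector whose interior knots are the interior mesh points of $\mathcal T_h$ (each with multiplicity one). Set $V_h:=\mathcal S^p(\mathcal T_h)\cap H^1_0(I)$. Dyadic coarsening: $\mathcal M_h^{(0)}=\mathcal T_h$ and for $k=1,\dots,L$ ($L\ge1$) the mesh $\mathcal M_h^{(k)}$ is obtained from $\mathcal M_h^{(k-1)}$ by removing every second interior knot, so that $\mathcal M_h^{(k)}$ has mesh size $2^kh$ and each element of $\mathcal M_h^{(L)}$ is the union of exactly $2^L$ elements of $\mathcal T_h$. Let $Q_L:=\mathcal S^{p-1}(\mathcal M_h^{(L)})$ be the univariate B-spline space of degree $p-1$ on the open knot vector associated with $\mathcal M_h^{(L)}$. *)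

(* Defs.v *)
From HB Require Import structures.
From mathcomp Require Import all_boot all_order all_algebra.
From mathcomp Require Import all_classical all_reals all_analysis.

Set Implicit Arguments.
Unset Strict Implicit.
Unset Printing Implicit Defensive.
Import Order.TTheory GRing.Theory Num.Theory.
Import numFieldNormedType.Exports.
Local Open Scope classical_set_scope.
Local Open Scope ring_scope.

Section Defs.
Variable R : realType.

Definition L2ip (a b : R) (u v : R -> R) : R :=
  \int[lebesgue_measure]_(x in `[a, b]) (u x * v x).
Definition L2norm (a b : R) (u : R -> R) : R := Num.sqrt (L2ip a b u u).

(* Open knot vector of degree p for the uniform mesh of [a, a + N*h]
   with N elements of size h: p+1 copies of a, the N-1 interior mesh
   points a + j*h (j = 1..N-1) each once, p+1 copies of a + N*h.
   Indices 0 .. N+2p. *)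
Definition open_knots (a h : R) (N p : nat) (i : nat) : R :=
  if (i <= p)%N then a
  else if (N + p <= i)%N then a + N%:R * h
  else a + (i - p)%:R * h.

(* B-splines by the Cox--de Boor recursion on knot sequence t, with the
   convention 0/0 = 0 (MathComp: x / 0 = 0), and degree-0 B-splines being
   indicators of [t_i, t_{i+1}), except that the last nonempty knot span
   (the one ending at the last knot tl) is closed on the right. *)
Fixpoint bspline (t : nat -> R) (tl : R) (p i : nat) (x : R) : R :=
  match p with
  | 0%N => if ((t i <= x) && (x < t i.+1))
              || [&& t i < t i.+1, t i.+1 == tl & x == tl] then 1 else 0
  | p'.+1 =>
      (x - t i) / (t (i + p'.+1)%N - t i) * bspline t tl p' i x
      + (t (i + p'.+2)%N - x) / (t (i + p'.+2)%N - t i.+1) * bspline t tl p' i.+1 x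
  end.

Definition spline_space (a h : R) (N p : nat) : set (R -> R) :=
  [set f | exists c : nat -> R,
     f = (fun x => \sum_(i < N + p) c i * bspline (open_knots a h N p)
                                       (a + N%:R * h) p i x)].

(* V_h = S^p(T_h) ∩ H^1_0(I): splines (which for p >= 2 are C^1 on I, hence
   in H^1(I)) vanishing at both endpoints of I. *)
Definition Vh (a h : R) (N p : nat) : set (R -> R) :=
  [set v | spline_space a h N p v /\ v a = 0 /\ v (a + N%:R * h) = 0].

(* Q_L = S^{p-1}(M_h^(L)): the mesh M_h^(L) obtained by L dyadic coarsenings
   of T_h is the uniform mesh of I with N / 2^L elements of size 2^L h. *)
Definition QL (a h : R) (N p L : nat) : set (R -> R) :=
  spline_space a ((2 ^ L)%:R * h) (N %/ 2 ^ L) p.-1.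

End Defs.

(* Main.v *)
Require Import Defs.
From HB Require Import structures.
From mathcomp Require Import all_boot all_order all_algebra.
From mathcomp Require Import all_classical all_reals all_analysis.
From mathcomp Require Import polyrcf lra ring zify.
Import Order.TTheory GRing.Theory Num.Theory.
Local Open Scope classical_set_scope.
Local Open Scope ring_scope.

Set Implicit Arguments.
Unset Strict Implicit.
Unset Printing Implicit Defensive.

(** Let [q] in [Q_L] be orthogonal to [V_h]. Integrating by parts against the
derivative formula for B-splines, the successive antiderivatives [F_k] of [q]
(with the right constants) are orthogonal to all B-splines of degree [p - k] on
the fine mesh and, for [k >= 2], vanish at both ends. So [F_p] has zero mean on
every fine element, and its antiderivative [G], a spline of degree [2p] on the
coarse mesh, vanishes at all [N] + 1 fine mesh points, and to order [p] at both
ends. If [G] vanishes on no element, Rolle's theorem gives [G'] at least [N]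
sign changes; each further derivative gains one up to order [p], thanks to the
zeros at the ends, and then loses at most one. Hence the [2p]-th derivative,
which is constant on each of the [N / 2^L] coarse elements, has at least [N - 1]
sign changes, which is too many. Otherwise one restricts to a maximal block of
coarse elements on none of which [G] vanishes. So [G = 0], whence [q = 0].

Thus [q] is determined, linearly, by its finitely many pairings with interior
B-splines, which bounds its norm by the largest of them. *)

(** * Elementary facts about real polynomials *)

Section Polynomials.
Variable R : rcfType.

(** A nonzero polynomial has fewer roots than its size, so [size P] distinct points of the interval
    cannot all be roots. *)
Lemma poly_nonroot (P : {poly R}) c d : P != 0 -> c < d ->
  exists2 x, c < x < d & P.[x] != 0.
Proof.
move=> P0 cd; pose n := size P.
pose f (i : nat) := c + (d - c) * (i.+1%:R / n.+1%:R).
have [|/allPn[x]] := boolP (all (root P) [seq f i | i <- iota 0 n]).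
  move=> /(max_poly_roots P0); rewrite size_map size_iota ltnn.
  suff -> : uniq [seq f i | i <- iota 0 n] by move=> /(_ isT).
  rewrite map_inj_uniq ?iota_uniq// => i j /addrI /mulfI.
  rewrite subr_eq0 gt_eqF// => /(_ isT) /mulIf.
  by rewrite invr_eq0 pnatr_eq0 => /(_ isT)/eqP; rewrite eqr_nat => /eqP[].
move=> /mapP[i]; rewrite mem_iota add0n => /andP[_ iN] -> nroot.
exists (f i) => //; rewrite /f.
have e : 0 < i.+1%:R / n.+1%:R :> R by rewrite divr_gt0.
have e1 : i.+1%:R / n.+1%:R < 1 :> R by rewrite ltr_pdivrMr// mul1r ltr_nat.
have dc : 0 < d - c by rewrite subr_gt0.
have := mulr_gt0 dc e; have := mulr_gt0 dc (etrans (subr_gt0 _ _) e1).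
by move: (_ / _) => t; rewrite mulrBr mulr1 => ? ?; apply/andP; split; lra.
Qed.

(** The factor [s] carries a sign, so that rises and falls are treated at once. *)
Lemma mvt_sgn (P : {poly R}) s x y : x <= y -> 0 < s * (P.[y] - P.[x]) ->
  exists2 z, x < z < y & 0 < s * P^`().[z].
Proof.
rewrite le_eqVlt => /predU1P[->|xy]; first by rewrite subrr mulr0 ltxx.
have [z zxy ->] := poly_mvt P xy.
rewrite mulrA pmulr_lgt0 ?subr_gt0// => sz.
by exists z => //; move: zxy; rewrite in_itv.
Qed.

Lemma poly_cst (P : {poly R}) x y : P^`() = 0 -> P.[x] = P.[y].
Proof.
move=> P0; wlog xy : x y / x < y => [hw|].
  by have [/hw|/hw//|->] := ltgtP x y.
have [z _ e] := poly_mvt P xy.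
by move: e; rewrite P0 horner0 mul0r => /eqP; rewrite subr_eq0 => /eqP.
Qed.

(* Invariance along blocks of [g] consecutive elements. *)
Definition coarse (g : nat) (F : nat -> {poly R}) :=
  forall j, ~~ (g %| j.+1)%N -> F j.+1 = F j.

Lemma coarseE g F j : (0 < g)%N -> coarse g F -> F j = F (j %/ g * g)%N.
Proof.
move=> g0 cF; rewrite [in LHS](divn_eq j g).
have := ltn_pmod j g0; elim: (j %% g)%N => [|r IH] rg; first by rewrite addn0.
rewrite addnS cF; first by apply: IH; lia.
by rewrite -addnS dvdn_addr ?dvdn_mull// gtnNdvd.
Qed.

Lemma signS i : (-1) ^+ i.+1 = - (-1) ^+ i :> R.
Proof. by rewrite exprS mulN1r. Qed.

End Polynomials.

(** * Sign changes of piecewise polynomials *)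

Section PiecewisePolynomials.
Variables (R : rcfType) (a h : R).
Hypothesis h_gt0 : 0 < h.

Definition mesh (j : nat) : R := a + j%:R * h.

Lemma mesh_lt j k : (j < k)%N -> mesh j < mesh k.
Proof. by move=> jk; rewrite /mesh ltrD2l ltr_pM2r// ltr_nat. Qed.

Lemma mesh_le j k : (j <= k)%N -> mesh j <= mesh k.
Proof. by move=> jk; rewrite /mesh lerD2l ler_pM2r// ler_nat. Qed.

(* Families [nat -> {poly R}] are piecewise polynomials: [F j] is the piece on
   [[mesh j, mesh j.+1]]. *)
Definition matches (N : nat) (F : nat -> {poly R}) :=
  forall j, (j.+1 < N)%N -> (F j).[mesh j.+1] = (F j.+1).[mesh j.+1].

(** Induction on the number of elements between [x] and [y]: by continuity the increment splits at
    [mesh i.+1], and one of the two parts has the sign of [s]. *)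
Lemma matches_mvt N F s i j x y : matches N F -> (i <= j < N)%N ->
  mesh i <= x <= mesh i.+1 -> mesh j <= y <= mesh j.+1 -> x <= y ->
  0 < s * ((F j).[y] - (F i).[x]) ->
  exists k z, [/\ (k < N)%N, mesh k < z < mesh k.+1, x < z < y
               & 0 < s * (F k)^`().[z]].
Proof.
move=> cF /andP[ij jN]; have [n nE] : exists n, j = (i + n)%N.
  by exists (j - i)%N; rewrite subnKC.
elim: n i x ij nE => [|n IH] i x ij nE /andP[xi xi1] /andP[yj yj1] xy Fxy.
  rewrite addn0 in nE; rewrite nE in jN yj yj1 Fxy.
  have [z /andP[xz zy] sz] := mvt_sgn xy Fxy.
  exists i, z; split; [exact: jN| | |exact: sz].
    by rewrite (le_lt_trans xi)//= (lt_le_trans zy).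
  by rewrite xz zy.
have ij1 : (i.+1 <= j)%N by rewrite nE addnS ltnS leq_addr.
have i1j : mesh i.+1 <= mesh j by exact: mesh_le.
have [c|c] := ltP 0 (s * ((F i).[mesh i.+1] - (F i).[x])).
  have [z /andP[xz zi] sz] := mvt_sgn xi1 c.
  exists i, z; split; [exact: leq_ltn_trans ij jN| | |exact: sz].
    by rewrite (le_lt_trans xi).
  by rewrite xz (lt_le_trans zi)// (le_trans i1j).
have e := cF i (leq_ltn_trans ij1 jN).
have [||||||k [z [kN kz /andP[iz zy] sz]]] := IH i.+1 (mesh i.+1).
- exact: ij1.
- by rewrite nE addnS.
- by rewrite lexx mesh_le.
- by rewrite yj yj1.
- exact: le_trans i1j yj.
- by rewrite -e; move: c Fxy; rewrite !mulrBr; lra.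
exists k, z; split; [exact: kN|exact: kz| |exact: sz].
by rewrite zy (le_lt_trans xi1 iz).
Qed.

(* [n] sign changes, witnessed by [n + 1] points interior to mesh elements. *)
Definition alternates (N : nat) (F : nat -> {poly R}) (n : nat) :=
  exists (s : R) (k : nat -> nat) (y : nat -> R),
    (forall i, (i <= n)%N -> [/\ (k i < N)%N, mesh (k i) < y i < mesh (k i).+1
                               & 0 < s * (-1) ^+ i * (F (k i)).[y i]])
    /\ (forall i, (i < n)%N -> y i < y i.+1).

Lemma elt_le k l y z : mesh k <= y -> z <= mesh l.+1 -> y < z -> (k <= l)%N.
Proof.
move=> ky zl yz; rewrite leqNgt; apply/negP => /mesh_le lk.
by have := le_lt_trans ky (lt_le_trans yz (le_trans zl lk)); rewrite ltxx.
Qed.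

(** Rolle's theorem for sign changes: the mean value theorem is applied between consecutive points
    of an up-and-down sequence of values. The points may lie at element ends, which admits the two
    ends of the mesh. *)
Lemma zigzag_alternates N F n s (k : nat -> nat) (y : nat -> R) :
  matches N F ->
  (forall i, (i <= n.+1)%N ->
     (k i < N)%N /\ mesh (k i) <= y i <= mesh (k i).+1) ->
  (forall i, (i <= n)%N ->
     [/\ (k i <= k i.+1)%N, y i <= y i.+1
       & 0 < s * (-1) ^+ i * ((F (k i.+1)).[y i.+1] - (F (k i)).[y i])]) ->
  alternates N (fun j => (F j)^`()) n.
Proof.
move=> cF yk inc.
have : forall i, exists u : nat * R, (i <= n)%N ->
    [/\ (u.1 < N)%N, mesh u.1 < u.2 < mesh u.1.+1, y i < u.2 < y i.+1
       & 0 < s * (-1) ^+ i * (F u.1)^`().[u.2]].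
  move=> i; have [lin|] := leqP i n; last by exists (0%N, 0).
  have [k1 k2 k3] := inc i lin.
  have [kN1 y1] := yk i (leqW lin); have [kN2 y2] := yk i.+1 lin.
  have [||||k' [z ?]] := @matches_mvt N F _ (k i) (k i.+1) (y i) (y i.+1) cF _ _ _ _ k3 => //.
    by rewrite k1.
  by exists (k', z).
move=> /choice[u uP]; exists s, (fun i => (u i).1), (fun i => (u i).2); split.
  by move=> i /uP[].
move=> i lin; have [_ _ /andP[_ u1] _] := uP i (ltnW lin).
by have [_ _ /andP[u2 _] _] := uP i.+1 lin; apply: lt_trans u1 u2.
Qed.

Lemma alternates_deriv N F n : matches N F -> alternates N F n.+1 ->
  alternates N (fun j => (F j)^`()) n.
Proof.
move=> cF [s [k [y [yk yinc]]]].
(* From [y i] to [y i.+1] the values pass from the sign of [s * (-1) ^+ i] to the opposite one,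
   hence [- s]. *)
apply: (@zigzag_alternates N F n (- s) k y) => // i lin.
  by have [? /andP[? ?] _] := yk i lin; split=> //; rewrite !ltW.
have [_ /andP[a1 a2] a3] := yk i (leqW lin).
have [_ /andP[b1 b2] b3] := yk i.+1 lin.
have yy := yinc i lin.
split; [exact: elt_le (ltW a1) (ltW b2) yy|exact: ltW|].
move: b3; rewrite signS; lra.
Qed.

(** The two end zeros extend the [n + 1] witnesses to [n + 3] points, with [n + 2] increments of
    alternating sign. *)
Lemma alternates_deriv_ends N F n : matches N F -> alternates N F n ->
  (F 0%N).[mesh 0] = 0 -> (F N.-1).[mesh N] = 0 ->
  alternates N (fun j => (F j)^`()) n.+1.
Proof.
move=> cF [s [k [y [yk yinc]]]] F0 FN.
have N0 : (0 < N)%N by have [] := yk 0%N isT; case: (N).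
have mN : mesh N.-1.+1 = mesh N by rewrite prednK.
pose k' i := if i is i'.+1 then if (i' <= n)%N then k i' else N.-1 else 0%N.
pose y' i := if i is i'.+1 then if (i' <= n)%N then y i' else mesh N else mesh 0.
apply: (@zigzag_alternates N F n.+1 s k' y') => // -[|i] lin /=.
- by split=> //; rewrite lexx mesh_le.
- case: (leqP i n) => [lin'|_]; last by rewrite mN lexx prednK// mesh_le ?leq_pred.
  by have [? /andP[? ?] _] := yk i lin'; split=> //; rewrite !ltW.
- have [kN /andP[a1 a2] a3] := yk 0%N isT.
  split=> //; first by rewrite (le_trans _ (ltW a1))// mesh_le.
  by rewrite F0 subr0.
rewrite ltnS in lin; rewrite lin.
have [kN /andP[a1 a2] a3] := yk i lin.
case: (ltnP i n) => [lin'|_].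
  have [_ /andP[b1 b2] b3] := yk i.+1 lin'.
  have yy := yinc i lin'.
  split; [exact: elt_le (ltW a1) (ltW b2) yy|exact: ltW|].
  by move: b3; rewrite signS; lra.
split; first by lia.
  by apply: le_trans (ltW a2) _; apply: mesh_le.
by rewrite FN sub0r signS; move: a3; lra.
Qed.

(** On each element [G j] is nonzero with zeros at both ends, so its derivative takes both signs
    there. One point per element would give [N - 1] sign changes; the first element supplies two
    points, hence [N]. *)
Lemma vanishing_alternates N G : (0 < N)%N ->
  (forall j, (j < N)%N -> [/\ G j != 0, (G j).[mesh j] = 0 & (G j).[mesh j.+1] = 0]) ->
  alternates N (fun j => (G j)^`()) N.
Proof.
move=> N0 GP.
have sgn_in j s : (j < N)%N -> s != 0 ->
    exists2 z, mesh j < z < mesh j.+1 & 0 < s * (G j)^`().[z].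
  move=> jN s0; have [Gj g0 g1] := GP j jN.
  have [m /andP[jm mj] Gm] := poly_nonroot Gj (mesh_lt (ltnSn j)).
  have [c|c] := ltP 0 (s * (G j).[m]).
    have [|z /andP[z1 z2] sz] := @mvt_sgn R (G j) s _ _ (ltW jm).
      by rewrite g0 subr0.
    by exists z => //; rewrite z1 (lt_trans z2).
  have [|z /andP[z1 z2] sz] := @mvt_sgn R (G j) s _ _ (ltW mj).
    by rewrite g1 sub0r mulrN oppr_gt0 lt_def c eq_sym mulf_neq0.
  by exists z => //; rewrite z2 (lt_trans jm).
have [G0 g0 g1] := GP 0%N N0.
have [m /andP[m0 m1] Gm] := poly_nonroot G0 (mesh_lt (ltnSn 0)).
pose s := (G 0%N).[m].
have ss : 0 < s * s by rewrite -expr2 exprn_even_gt0.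
(* Index [i] uses element [i.-1], so that 0 and 1 share the first element, on either side of the
   nonroot [m]. *)
have : forall i, exists z, (i <= N)%N ->
   [/\ mesh i.-1 < z < mesh i.-1.+1, 0 < s * (-1) ^+ i * (G i.-1)^`().[z],
       (i = 0%N -> z < m) & (i = 1%N -> m < z)].
  case=> [|[|i]].
  - have [|z /andP[z1 z2] sz] := @mvt_sgn R (G 0%N) s _ _ (ltW m0).
      by rewrite g0 subr0.
    by exists z => _; rewrite expr0 mulr1; split; rewrite // z1 (lt_trans z2).
  - have [|z /andP[z1 z2] sz] := @mvt_sgn R (G 0%N) (- s) _ _ (ltW m1).
      by rewrite g1 sub0r mulrNN.
    by exists z => _; rewrite expr1 mulrN1; split; rewrite //= z2 (lt_trans m0).
  - have [iN|] := ltnP i.+1 N; last by exists 0; lia.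
    have [|z zP sz] := @sgn_in i.+1 (s * (-1) ^+ i.+2) iN.
      by rewrite mulf_neq0// expf_eq0 oppr_eq0 oner_eq0 andbF.
    by exists z.
move=> /choice[y yP]; exists s, predn, y; split=> i lin.
  by have [? ? _ _] := yP i lin; split=> //; lia.
case: i lin => [|i] lin.
  have [_ _ /(_ erefl) l0 _] := yP 0%N isT.
  by have [_ _ _ /(_ erefl) l1] := yP 1%N lin; exact: lt_trans l0 l1.
have [/andP[_ l1] _ _ _] := yP i.+1 (ltnW lin).
by have [/andP[l2 _] _ _ _] := yP i.+2 lin; exact: lt_trans l1 l2.
Qed.

Section Core.
Variables (p g : nat).
Hypotheses (p_gt0 : (0 < p)%N) (g_gt1 : (1 < g)%N).

(** At order [2p] there remain [N] points of alternating sign, which must lie in distinct blocks of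
    [g] elements; but there are only [M < N] blocks. *)
Lemma spline_zeros_absurd M G : let N := (M * g)%N in (0 < M)%N ->
  coarse g G ->
  (forall s, (s < p.*2)%N -> matches N (fun j => (G j)^`(s))) ->
  (forall s, (s < p)%N -> (G 0%N)^`(s).[mesh 0] = 0) ->
  (forall s, (s < p)%N -> (G N.-1)^`(s).[mesh N] = 0) ->
  (forall j, (j < N)%N -> (G j).[mesh j] = 0) ->
  (forall j, (j < N)%N -> (G j).[mesh j.+1] = 0) ->
  (forall j, (G j)^`(p.*2.+1) = 0) ->
  (forall j, (j < N)%N -> G j != 0) -> False.
Proof.
move=> N M0 cG mG G0 GN Gj Gj1 Gp Gn.
have N0 : (0 < N)%N by rewrite muln_gt0 M0; lia.
(* Up to order [p] each derivative gains one sign change from the zeros at both ends. *)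
have up k : (k < p)%N -> alternates N (fun j => (G j)^`(k.+1)) (N + k).
  elim: k => [|k IH] kp.
    rewrite addn0; under eq_fun do rewrite derivn1.
    by apply: vanishing_alternates => // j jN; split; auto.
  under eq_fun do rewrite derivnS.
  rewrite addnS; apply: alternates_deriv_ends; [apply: mG; lia|apply: IH; lia| |].
    exact: G0.
  exact: GN.
(* From order [p] to [2p] each derivative costs one sign change. *)
have down k : (k <= p)%N -> alternates N (fun j => (G j)^`(p + k)) (N + p.-1 - k).
  elim: k => [|k IH] kp.
    by rewrite addn0 subn0; have := up p.-1; rewrite prednK//; apply.
  rewrite addnS; under eq_fun do rewrite derivnS.
  apply: alternates_deriv; first by apply: mG; lia.
  have -> : (N + p.-1 - k.+1).+1 = (N + p.-1 - k)%N by lia.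
  by apply: IH; lia.
have [s [k [y [yk yinc]]]] := down p (leqnn p).
have {}yk i : (i < N)%N ->
    [/\ (k i < N)%N, mesh (k i) < y i < mesh (k i).+1
      & 0 < s * (-1) ^+ i * ((G (k i))^`(p + p)).[y i]].
  by move=> iN; apply: yk; lia.
have {}yinc i : (i.+1 < N)%N -> y i < y i.+1 by move=> iN; apply: yinc; lia.
(* The derivative of order [2p] is constant on a block, so consecutive witnesses, having opposite
   signs, lie in different blocks. *)
have kinc i : (i < N)%N -> (i <= k i %/ g)%N.
  elim: i => [//|i IH] iN.
  have {}IH := IH (ltnW iN); apply: (leq_ltn_trans IH).
  have [_ /andP[a1 a2] a3] := yk i (ltnW iN).
  have [_ /andP[b1 b2] b3] := yk i.+1 iN.
  have kk := elt_le (ltW a1) (ltW b2) (yinc i iN).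
  rewrite ltn_neqAle leq_div2r// andbT; apply/eqP => e.
  have Ge : G (k i.+1) = G (k i).
    have g0 := ltnW g_gt1.
    by rewrite (coarseE _ g0 cG) -e -coarseE.
  move: b3; rewrite signS Ge (@poly_cst R _ (y i.+1) (y i)).
    by move: a3; lra.
  by rewrite -derivnS addnn.
have [kN _ _] := yk N.-1 ltac:(lia).
have := kinc N.-1 ltac:(lia).
have : (k N.-1 %/ g < M)%N by rewrite ltn_divLR//; lia.
have : (M * 2 <= N)%N by rewrite leq_mul2l g_gt1 orbT.
lia.
Qed.

End Core.
End PiecewisePolynomials.

Section Uniqueness.
Variables (R : rcfType) (a h : R).
Hypothesis h_gt0 : 0 < h.
Variables (p g : nat).
Hypotheses (p_gt0 : (0 < p)%N) (g_gt1 : (1 < g)%N).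

Lemma mesh_shift m j : mesh (mesh a h m) h j = mesh a h (m + j).
Proof. by rewrite /mesh natrD mulrDl addrA. Qed.

(** The conditions of [spline_zeros_absurd] pass to a maximal run of nonzero blocks: where the run
    stops inside the mesh, the neighbouring piece is zero and [matches] carries its vanishing
    derivatives over. *)
Lemma spline_zeros_eq0 M (N := (M * g)%N) G : (0 < M)%N ->
  coarse g G ->
  (forall s, (s < p.*2)%N -> matches a h N (fun j => (G j)^`(s))) ->
  (forall s, (s < p)%N -> (G 0%N)^`(s).[mesh a h 0] = 0) ->
  (forall s, (s < p)%N -> (G N.-1)^`(s).[mesh a h N] = 0) ->
  (forall j, (j < N)%N -> (G j).[mesh a h j] = 0) ->
  (forall j, (j < N)%N -> (G j).[mesh a h j.+1] = 0) ->
  (forall j, (G j)^`(p.*2.+1) = 0) ->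
  forall j, (j < N)%N -> G j = 0.
Proof.
move=> M0 cG mG G0 GN Gj Gj1 Gp j jN; apply/eqP/negPn/negP => Gj0.
have g0 : (0 < g)%N by lia.
pose nz J := (J < M)%N && (G (J * g)%N != 0).
have nzE i : (i < N)%N -> (G i != 0) = nz (i %/ g)%N.
  by move=> iN; rewrite /nz -coarseE// ltn_divLR// iN.
have exJ : exists J, nz J by exists (j %/ g)%N; rewrite -nzE.
case: (ex_minnP exJ) => J0 nz0 J0min.
(* Since [nz] demands [J < M], the end of the mesh also stops the run. *)
pose stop J := (J0 < J)%N && ~~ nz J.
have J0M : (J0 < M)%N by case/andP: nz0.
have exS : exists J, stop J by exists M; rewrite /stop J0M /nz ltnn.
case: (ex_minnP exS) => J1 /andP[J01 nz1] J1min.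
have J1M : (J1 <= M)%N by apply: J1min; rewrite /stop J0M /nz ltnn.
have run J : (J0 <= J < J1)%N -> nz J.
  case/andP; rewrite leq_eqVlt => /predU1P[<-//|J0J JJ1].
  apply/negPn/negP => nzJ; have := J1min J; rewrite /stop J0J nzJ => /(_ isT).
  by lia.
pose m := (J0 * g)%N; pose M' := (J1 - J0)%N; pose N' := (M' * g)%N.
have mN' : (m + N' = J1 * g)%N by rewrite /N' mulnBl subnKC// leq_mul2r ltnW ?orbT.
have mN'N : (m + N' <= N)%N by rewrite mN' leq_mul2r J1M orbT.
have N'0 : (0 < N')%N by rewrite muln_gt0 subn_gt0 J01.
have Gm' s : (s < p)%N -> (G m)^`(s).[mesh a h m] = 0.
  move=> sp; case: (posnP J0) => [J00|J00]; first by rewrite /m J00 mul0n; exact: G0.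
  have m0 : (0 < m)%N by rewrite muln_gt0 J00.
  have e : G m.-1 = 0.
    apply/eqP/negPn/negP; rewrite nzE; last by lia.
    move=> /J0min; have : (m.-1 %/ g < J0)%N by rewrite ltn_divLR//; lia.
    by lia.
  have := mG s ltac:(lia) m.-1 ltac:(lia).
  by rewrite prednK// e linear0 horner0.
have Gn' s : (s < p)%N -> (G (m + N').-1)^`(s).[mesh a h (m + N')] = 0.
  move=> sp; have [J1e|J1l] : J1 = M \/ (J1 < M)%N by lia.
    by rewrite mN' J1e; exact: GN.
  have lt1 : (m + N' < N)%N by rewrite mN' ltn_mul2r g0 J1l.
  have e : G (m + N')%N = 0.
    by apply/eqP/negPn; rewrite nzE// mN' mulnK.
  have := mG s ltac:(lia) (m + N').-1; rewrite prednK; last by lia.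
  by move=> /(_ lt1) ->; rewrite e linear0 horner0.
(* The run becomes a mesh of its own, based at [mesh a h m]. *)
apply: (@spline_zeros_absurd R (mesh a h m) h h_gt0 p g p_gt0 g_gt1 M' (fun j => G (m + j)%N)).
- by rewrite subn_gt0.
- by move=> i gi; rewrite addnS cG// -addnS dvdn_addr// dvdn_mull.
- move=> s sp i iN; rewrite mesh_shift addnS.
  by apply: mG => //; rewrite -addnS; move: iN mN'N; rewrite /N'; lia.
- by move=> s sp; rewrite mesh_shift addn0; exact: Gm'.
- move=> s sp; rewrite mesh_shift.
  have -> : (m + (M' * g).-1 = (m + N').-1)%N by rewrite /N'; lia.
  exact: Gn'.
- by move=> i iN; rewrite mesh_shift; apply: Gj; rewrite -/N' in iN; lia.
- by move=> i iN; rewrite mesh_shift addnS; apply: Gj1; rewrite -/N' in iN; lia.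
- by move=> i; exact: Gp.
- move=> i iN; rewrite -/N' in iN; rewrite nzE; last by lia.
  apply: run; rewrite leq_divRL// ltn_divLR//; lia.
Qed.

End Uniqueness.

(** * Polynomial integrals *)

Section Antiderivative.
Variable R : rcfType.
Implicit Types P Q : {poly R}.

Definition antideriv P : {poly R} :=
  \poly_(i < (size P).+1) (if i is i'.+1 then P`_i' / i'.+1%:R else 0).

Lemma antiderivK P : (antideriv P)^`() = P.
Proof.
apply/polyP => i; rewrite coef_deriv coef_poly ltnS.
have [iP|iP] := ltnP i (size P); first by rewrite /= -[LHS]mulr_natr divfK// pnatr_eq0.
by rewrite mul0rn nth_default.
Qed.

(** The integral is kept algebraic; [poly_Rintegral] identifies it with Lebesgue's. *)
Definition pint (c d : R) P := (antideriv P).[d] - (antideriv P).[c].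

Lemma pint_deriv c d P : pint c d P^`() = P.[d] - P.[c].
Proof.
rewrite /pint; have := @poly_cst R (antideriv P^`() - P) d c.
rewrite derivB antiderivK subrr => /(_ erefl); rewrite !hornerE; lra.
Qed.

Lemma pintE c d P Q : Q^`() = P -> pint c d P = Q.[d] - Q.[c].
Proof. by move=> <-; exact: pint_deriv. Qed.

Lemma pintD c d P Q : pint c d (P + Q) = pint c d P + pint c d Q.
Proof.
rewrite (@pintE c d _ (antideriv P + antideriv Q)) ?derivD ?antiderivK//.
by rewrite /pint !(hornerD, hornerZ); ring.
Qed.

Lemma pintZ c d x P : pint c d (x *: P) = x * pint c d P.
Proof.
rewrite (@pintE c d _ (x *: antideriv P)) ?derivZ ?antiderivK//.
by rewrite /pint !(hornerD, hornerZ); ring.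
Qed.

Lemma pint0 c d : pint c d 0 = 0.
Proof. by rewrite (@pintE c d 0 0) ?deriv0// !horner0 subrr. Qed.

Lemma pint_sqr_ge0 c d P : c <= d -> 0 <= pint c d (P * P).
Proof.
rewrite le_eqVlt => /predU1P[->|cd]; first by rewrite /pint subrr.
have [z _] := poly_mvt (antideriv (P * P)) cd.
rewrite /pint => ->; rewrite antiderivK hornerM -expr2.
by rewrite mulr_ge0 ?sqr_ge0// subr_ge0 ltW.
Qed.

(** By additivity and nonnegativity the integral from [c] to any [x] vanishes, so the antiderivative
    of [P * P] is constant on the interval, hence as a polynomial. *)
Lemma pint_sqr_eq0 c d P : c < d -> pint c d (P * P) = 0 -> P = 0.
Proof.
move=> cd P0; apply/eqP/negPn/negP => Pn0.
have splitP x : pint c x (P * P) + pint x d (P * P) = 0.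
  by rewrite -P0 /pint; ring.
have ge0 x y := @pint_sqr_ge0 x y P.
have cst x : c <= x <= d -> pint c x (P * P) = 0.
  by move=> /andP[/ge0 ? /ge0 ?]; have := splitP x; lra.
have [x /andP[cx xd] Px] := poly_nonroot Pn0 cd.
have Q0 : antideriv (P * P) - ((antideriv (P * P)).[c])%:P = 0.
  apply/eqP/negPn/negP => Qn0.
  have [y /andP[cy yd]] := poly_nonroot Qn0 cd.
  have := cst y; rewrite /pint !hornerE !ltW// => /(_ isT) ->.
  by rewrite eqxx.
have := congr1 deriv Q0; rewrite derivB antiderivK derivC subr0 deriv0.
by move=> /eqP; rewrite mulf_eq0 orbb (negPf Pn0).
Qed.

End Antiderivative.

(** * B-splines as piecewise polynomials *)

Section BsplinePieces.
Variables (R : rcfType) (t : nat -> R).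
Hypothesis t_mono : forall i j, (i <= j)%N -> t i <= t j.

(* Equal to 0 when the knots coincide, as the Cox--de Boor convention asks. *)
Definition wt d i : R := (t (i + d.+1)%N - t i)^-1.

(* [bpiece d i m] is the polynomial that the B-spline of degree [d] and index
   [i] agrees with on the knot span [[t m, t m.+1[]. *)
Fixpoint bpiece (d i m : nat) : {poly R} :=
  if d is d'.+1 then
    (wt d' i)%:P * (('X - (t i)%:P) * bpiece d' i m)
    + (wt d' i.+1)%:P * (((t (i.+1 + d'.+1)%N)%:P - 'X) * bpiece d' i.+1 m)
  else ((i == m)%:R)%:P.

Lemma bpieceS d i m : bpiece d.+1 i m =
  (wt d i)%:P * (('X - (t i)%:P) * bpiece d i m)
  + (wt d i.+1)%:P * (((t (i.+1 + d.+1)%N)%:P - 'X) * bpiece d i.+1 m).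
Proof. by []. Qed.

Lemma bpiece_support d i m : bpiece d i m != 0 -> (i <= m <= i + d)%N.
Proof.
elim: d i => [|d IH] i /=.
  by case: (i =P m) => [->|_]; rewrite ?addn0 ?leqnn// eqxx.
have [->|/IH imd _] := eqVneq (bpiece d i m) 0; last by lia.
have [->|/IH imd _] := eqVneq (bpiece d i.+1 m) 0; last by lia.
by rewrite !mulr0 addr0 eqxx.
Qed.

(** Used to show that the denominators of the recursion are invertible wherever the B-spline is
    nonzero. *)
Lemma bpiece_knots d i m : t m < t m.+1 -> bpiece d i m != 0 ->
  t i < t (i + d.+1)%N.
Proof.
move=> tm /bpiece_support/andP[im mi].
apply: le_lt_trans (t_mono im) (lt_le_trans tm _).
by apply: t_mono; rewrite addnS ltnS.
Qed.

Lemma bpiece_wt0 d i m : t m < t m.+1 -> wt d i = 0 -> bpiece d i m = 0.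
Proof.
move=> tm /eqP; rewrite invr_eq0 subr_eq0 => /eqP w0.
by apply/eqP/negPn/negP => /(bpiece_knots tm); rewrite w0 ltxx.
Qed.

Lemma bpiece_deriv d i m : t m < t m.+1 ->
  (bpiece d.+1 i m)^`() =
  d.+1%:R *: (wt d i *: bpiece d i m - wt d i.+1 *: bpiece d i.+1 m).
Proof.
move=> tm; rewrite -!mul_polyC polyC_natr.
elim: d i => [|d IH] i.
  by rewrite /= !poly.derivE; ring.
rewrite bpieceS.
rewrite derivD !derivM !IH !poly.derivE.
(* Where the middle B-spline is nonzero, each outer weight cancels its knot difference; elsewhere
   both sides are zero. *)
have key : (wt d i.+1)%:P * bpiece d i.+1 m *
      ((wt d.+1 i)%:P * ((t (i.+1 + d.+1)%N)%:P - (t i)%:P)) =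
    (wt d i.+1)%:P * bpiece d i.+1 m *
      ((wt d.+1 i.+1)%:P * ((t (i.+1 + d.+2)%N)%:P - (t i.+1)%:P)).
  have [->|/(bpiece_knots tm) tt] := eqVneq (bpiece d i.+1 m) 0.
    by rewrite mulr0 !mul0r.
  rewrite -!polyCB -!polyCM /wt.
  have -> : (i + d.+2 = i.+1 + d.+1)%N by lia.
  rewrite !mulVf// subr_eq0 gt_eqF//.
    by apply: lt_le_trans tt (t_mono _); lia.
  by apply: le_lt_trans tt; apply: t_mono.
have e : (i.+2 + d.+1 = i.+1 + d.+2)%N by lia.
apply: subr0_eq; move/eqP: key; rewrite -subr_eq0 => /eqP key.
(* The two sides of the derivative formula differ by a multiple of the difference in [key]. *)
rewrite [LHS](_ : _ = d.+1%:R * - ((wt d i.+1)%:P * bpiece d i.+1 m *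
      ((wt d.+1 i)%:P * ((t (i.+1 + d.+1)%N)%:P - (t i)%:P)) -
    (wt d i.+1)%:P * bpiece d i.+1 m *
      ((wt d.+1 i.+1)%:P * ((t (i.+1 + d.+2)%N)%:P - (t i.+1)%:P)))).
  by rewrite key oppr0 mulr0.
rewrite /= e -[d.+2%:R]natr1; ring.
Qed.

(** The recursion has the same factors on both spans, so matching passes from degree to degree; the
    base case is the hat function. *)
Lemma bpiece_match d i m : t m < t m.+1 -> t m.+1 < t m.+2 ->
  (bpiece d.+1 i m).[t m.+1] = (bpiece d.+1 i m.+1).[t m.+1].
Proof.
move=> tm tm1; elim: d i => [|d IH] i; last first.
  rewrite bpieceS [in RHS]bpieceS; move: (IH i) (IH i.+1).
  move: (bpiece _ i m) (bpiece _ i.+1 m) (bpiece _ i m.+1) (bpiece _ i.+1 m.+1).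
  by move=> P0 P1 Q0 Q1; rewrite !(hornerD, hornerM) => -> ->.
rewrite /= !(hornerD, hornerN, hornerM, hornerC, hornerX) /wt addn1.
have tm0 : t m.+1 - t m != 0 by rewrite subr_eq0 gt_eqF.
have tm10 : t m.+2 - t m.+1 != 0 by rewrite subr_eq0 gt_eqF.
have [->|ne1] := eqVneq i m.
  rewrite eqxx !addn1 gtn_eqF ?ltnn// (_ : (m == m.+1) = false); last by lia.
  by rewrite !mulr0 !mulr1 !mulVf// addr0 add0r.
have [->|ne2] := eqVneq i m.+1.
  have -> : (m.+2 == m) = false by lia.
  have -> : (m.+2 == m.+1) = false by lia.
  by rewrite subrr !mul0r !mulr0 !addr0.
have -> : (i.+1 == m.+1) = false by lia.
have [<-|ne3] := eqVneq i.+1 m; last by rewrite !mulr0.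
by rewrite addn1 subrr !mul0r !mulr0.
Qed.

Lemma bpiece_derivn_match d i m s : t m < t m.+1 -> t m.+1 < t m.+2 ->
  (s < d)%N ->
  (bpiece d i m)^`(s).[t m.+1] = (bpiece d i m.+1)^`(s).[t m.+1].
Proof.
move=> tm tm1; elim: s d i => [|s IH] [//|d] i sd; first exact: bpiece_match.
rewrite !derivSn !bpiece_deriv// !(derivnZ, derivnB, hornerZ).
by rewrite !(derivnZ, hornerD, hornerN, hornerZ) !IH.
Qed.

(** Where the knots coincide, each linear factor that matters in the recursion either vanishes or
    cancels its weight. The values become boundary terms in [ip_deriv_bfam]. *)
Lemma bpiece_left d i p : (forall k, (k <= p)%N -> t k = t p) ->
  t p < t p.+1 -> (bpiece d i p).[t p] = (i + d == p)%N%:R.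
Proof.
move=> tp tp1; elim: d i => [|d IH] i; first by rewrite /= hornerC addn0.
rewrite /= !(hornerD, hornerN, hornerM, hornerC, hornerX) !IH.
have -> : (i.+1 + d == p)%N = (i + d.+1 == p)%N by rewrite addSnnS.
have [e|ne] := eqVneq (i + d)%N p.
  have -> : (i + d.+1 == p)%N = false by lia.
  rewrite tp; last by lia.
  by rewrite subrr mul0r !mulr0 addr0.
rewrite !mulr0 add0r; have [e|] := eqVneq (i + d.+1)%N p; last by rewrite !mulr0.
rewrite mulr1 /wt (tp i.+1) ?mulVf//; last by lia.
by rewrite subr_eq0 gt_eqF// (_ : i.+1 + d.+1 = p.+1)%N//; lia.
Qed.

Lemma bpiece_right d i m : (forall k, (m < k)%N -> t k = t m.+1) ->
  t m < t m.+1 -> (bpiece d i m).[t m.+1] = (i == m)%:R.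
Proof.
move=> tm tm1; elim: d i => [|d IH] i; first by rewrite /= hornerC.
rewrite /= !(hornerD, hornerN, hornerM, hornerC, hornerX) !IH.
have [im|ne] := eqVneq i.+1 m.
  subst m.
  rewrite ltn_eqF// !mulr0 add0r (tm (i.+1 + d.+1)%N); last by lia.
  by rewrite subrr mul0r mulr0.
rewrite !mulr0 addr0; have [->|] := eqVneq i m; last by rewrite !mulr0.
rewrite mulr1 /wt (tm (m + d.+1)%N) ?mulVf//; last by lia.
by rewrite subr_eq0 gt_eqF.
Qed.

End BsplinePieces.

(** * Continuous antiderivatives and integration by parts *)

Section Families.
Variables (R : rcfType) (a h : R).
Local Notation x := (mesh a h).
Implicit Types (F U W : nat -> {poly R}).

Definition ip N F W : R := \sum_(j < N) pint (x j) (x j.+1) (F j * W j).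

(** The continuous antiderivative with value [c] at the left end: each local one is made zero at the
    left of its element, then raised by the integrals over the elements before it. *)
Definition pw_antideriv c F (j : nat) : {poly R} :=
  antideriv (F j) - ((antideriv (F j)).[x j])%:P
  + (c + \sum_(i < j) pint (x i) (x i.+1) (F i))%:P.

Lemma pw_antiderivK c F j : (pw_antideriv c F j)^`() = F j.
Proof. by rewrite /pw_antideriv !poly.derivE antiderivK subr0 addr0. Qed.

Lemma pw_antideriv_left c F j :
  (pw_antideriv c F j).[x j] = c + \sum_(i < j) pint (x i) (x i.+1) (F i).
Proof. by rewrite /pw_antideriv !(hornerD, hornerN, hornerC) subrr add0r. Qed.

Lemma pw_antideriv_right c F j :
  (pw_antideriv c F j).[x j.+1] = c + \sum_(i < j.+1) pint (x i) (x i.+1) (F i).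
Proof.
by rewrite /pw_antideriv !(hornerD, hornerN, hornerC) big_ord_recr /= {3}/pint; ring.
Qed.

Lemma pw_antideriv_matches c F N : matches a h N (pw_antideriv c F).
Proof. by move=> j _; rewrite pw_antideriv_left pw_antideriv_right. Qed.

(** Inside a block, moving the base point to the next mesh point is made up for by the integral
    added to the sum. *)
Lemma pw_antideriv_coarse c F g : coarse g F -> coarse g (pw_antideriv c F).
Proof.
move=> cF j gj; rewrite /pw_antideriv cF// big_ord_recr /= {2}/pint.
by rewrite !(polyCD, polyCN); ring.
Qed.

Lemma pw_antideriv_cst c F j : pw_antideriv c F j = pw_antideriv 0 F j + c%:P.
Proof. by rewrite /pw_antideriv !polyCD; ring. Qed.

Lemma ip_parts N U W : (0 < N)%N -> matches a h N U -> matches a h N W ->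
  ip N (fun j => (U j)^`()) W =
  (U N.-1).[x N] * (W N.-1).[x N] - (U 0%N).[x 0] * (W 0%N).[x 0]
  - ip N U (fun j => (W j)^`()).
Proof.
case: N => // N _ mU mW; apply/esym/eqP; rewrite subr_eq; apply/eqP/esym.
rewrite /ip -big_split /=; under eq_bigr do rewrite -pintD -derivM pint_deriv !hornerM.
elim: N mU mW => [|N IH] mU mW; first by rewrite big_ord1.
rewrite big_ord_recr /= IH; last first.
- by move=> j jN; apply: mW; lia.
- by move=> j jN; apply: mU; lia.
by rewrite mU// mW//; ring.
Qed.

Lemma ipDl N F G W : ip N (fun j => F j + G j) W = ip N F W + ip N G W.
Proof. by rewrite /ip -big_split /=; under eq_bigr do rewrite mulrDl pintD. Qed.

Lemma ipZl N c F W : ip N (fun j => c *: F j) W = c * ip N F W.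
Proof. by rewrite /ip mulr_sumr; under eq_bigr do rewrite -scalerAl pintZ. Qed.

Lemma ipC N F W : ip N F W = ip N W F.
Proof. by rewrite /ip; under eq_bigr do rewrite mulrC. Qed.

End Families.

Lemma derivn_add (R : nzRingType) (P : {poly R}) m n :
  P^`(m + n) = P^`(m)^`(n).
Proof. by rewrite addnC /derivn iterD. Qed.

(** * Orthogonality to B-splines *)

Section Orthogonality.
Variables (R : rcfType) (a h : R) (N p : nat).
Local Notation x := (mesh a h).
Implicit Types (F U W q : nat -> {poly R}).

(** Truncated subtraction repeats the left end and [minn] the right end; [open_knotsE] identifies
    this with [open_knots]. *)
Definition knots (i : nat) : R := x (minn (i - p) N).

Lemma knots_left i : (i <= p)%N -> knots i = x 0.
Proof. by move=> ip; rewrite /knots; congr mesh; lia. Qed.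

Lemma knots_right i : (p + N <= i)%N -> knots i = x N.
Proof. by move=> ip; rewrite /knots; congr mesh; lia. Qed.

Lemma knots_mid j : (j <= N)%N -> knots (p + j) = x j.
Proof. by move=> jN; rewrite /knots; congr mesh; lia. Qed.

Hypothesis h_gt0 : 0 < h.

Lemma knots_mono i j : (i <= j)%N -> knots i <= knots j.
Proof. by move=> ij; apply: mesh_le => //; lia. Qed.

Lemma knots_lt j : (j < N)%N -> knots (p + j) < knots (p + j).+1.
Proof. by move=> jN; rewrite -addnS !knots_mid ?mesh_lt// ltnW. Qed.

(** The first [p] knot spans are empty, so mesh element [j] is knot span [p + j]. *)
Definition bspline_fam d i (j : nat) : {poly R} := bpiece knots d i (p + j).

Lemma bspline_fam_derivn_match d i s : (s < d)%N ->
  matches a h N (fun j => (bspline_fam d i j)^`(s)).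
Proof.
move=> sd j jN; have := knots_lt jN; rewrite addnS => t1.
rewrite -(knots_mid (ltnW jN)) /bspline_fam !addnS.
exact: (bpiece_derivn_match knots_mono i (knots_lt (ltnW jN)) t1 sd).
Qed.

Hypothesis N_gt0 : (0 < N)%N.

Lemma bspline_fam_left d i : (bspline_fam d i 0).[x 0] = (i + d == p)%N%:R.
Proof.
rewrite /bspline_fam addn0 -(knots_left (leqnn p)); apply: bpiece_left => [k kp|].
  by rewrite !knots_left.
by have := knots_lt N_gt0; rewrite addn0.
Qed.

Lemma bspline_fam_right d i : (bspline_fam d i N.-1).[x N] = (i == p + N.-1)%N%:R.
Proof.
have e : (p + N.-1).+1 = (p + N)%N by lia.
have -> : x N = knots (p + N.-1).+1 by rewrite e knots_mid.
apply: bpiece_right => [k kp|]; first by rewrite e !knots_right//; lia.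
by apply: knots_lt; rewrite prednK.
Qed.

Lemma ip_bfam_wt0 d i U : wt knots d i = 0 -> ip a h N U (bspline_fam d i) = 0.
Proof.
move=> w0; rewrite /ip big1// => j _.
rewrite /bspline_fam bpiece_wt0 ?mulr0//; first by exact: pint0.
  exact: knots_mono.
exact: knots_lt.
Qed.

Definition moment d U i : R := wt knots d i * ip a h N U (bspline_fam d i).

(** Integration by parts, with [bpiece_deriv] for the derivative of the B-spline and its end values
    for the boundary terms. *)
Lemma ip_deriv_bfam d i U : matches a h N U ->
  ip a h N (fun j => (U j)^`()) (bspline_fam d.+1 i) =
  (U N.-1).[x N] * (i == p + N.-1)%N%:R - (U 0%N).[x 0] * (i + d.+1 == p)%N%:R
  - d.+1%:R * (moment d U i - moment d U i.+1).
Proof.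
move=> mU; rewrite ip_parts//; last exact: (bspline_fam_derivn_match i (ltn0Sn d)).
rewrite bspline_fam_left bspline_fam_right; congr (_ - _).
rewrite /moment /ip !mulr_sumr -sumrB mulr_sumr.
apply: eq_bigr => j _; rewrite /bspline_fam bpiece_deriv//; first last.
- exact: knots_lt.
- exact: knots_mono.
rewrite -!pintZ -[- pint _ _ _]mulN1r -pintZ -pintD -pintZ; congr pint.
by rewrite -!mul_polyC polyCN; ring.
Qed.

Lemma moment0 d U i : wt knots d i = 0 -> moment d U i = 0.
Proof. by move=> w0; rewrite /moment w0 mul0r. Qed.

Lemma moment_eq0 d U i : moment d U i = 0 -> ip a h N U (bspline_fam d i) = 0.
Proof. by move=> /eqP; rewrite mulf_eq0 => /orP[/eqP/ip_bfam_wt0|/eqP]. Qed.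

Lemma wt_left d i : (i + d.+1 <= p)%N -> wt knots d i = 0.
Proof.
move=> idp; rewrite /wt !knots_left ?subrr ?invr0//.
by apply: leq_trans idp; rewrite leq_addr.
Qed.

Lemma wt_right d i : (p + N <= i)%N -> wt knots d i = 0.
Proof.
move=> idp; rewrite /wt !knots_right ?subrr ?invr0//.
by apply: (leq_trans idp); rewrite leq_addr.
Qed.

(* By [ip_deriv_bspline_fam] consecutive moments are equal, and those at both
   ends vanish because their weight does. *)
Lemma ortho_antideriv d U : (d < p)%N -> matches a h N U ->
  (U 0%N).[x 0] = 0 ->
  (forall i, ip a h N (fun j => (U j)^`()) (bspline_fam d.+1 i) = 0) ->
  (forall i, ip a h N U (bspline_fam d i) = 0) /\ (U N.-1).[x N] = 0.
Proof.
move=> dp mU U0 oU.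
have dn : d.+1%:R != 0 :> R by rewrite pnatr_eq0.
have mu i : moment d U i = 0.
  elim: i => [|i IH]; first by rewrite moment0 ?wt_left.
  have [iN|iN] := leqP (p + N) i.+1; first by rewrite moment0// wt_right.
  have := ip_deriv_bfam d i mU; rewrite oU U0 IH sub0r mul0r subr0.
  have -> : (i == p + N.-1)%N = false by lia.
  rewrite mulr0 sub0r mulrN opprK => /esym/eqP.
  by rewrite mulf_eq0 (negPf dn) => /eqP.
split=> [i|]; first exact: moment_eq0.
(* For the last B-spline the boundary term at the right end remains, and all else is zero. *)
have := ip_deriv_bfam d (p + N.-1) mU; rewrite oU U0 !mu eqxx.
by rewrite mul0r subrr mulr0 mulr1 !subr0.
Qed.

(* Nothing is known of the pairing with the first and last B-splines here, so
   that the integration constant is what cancels the first moment. *)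
Lemma ortho_antideriv_first d q : d.+1 = p ->
  (forall i, i != 0%N -> i != (p + N.-1)%N -> ip a h N q (bspline_fam p i) = 0) ->
  exists c, forall i, ip a h N (pw_antideriv a h c q) (bspline_fam d i) = 0.
Proof.
move=> dp oq.
have dn : d.+1%:R != 0 :> R by rewrite pnatr_eq0.
pose U0 := pw_antideriv a h 0 q; pose one := fun _ : nat => 1 : {poly R}.
have m0 U : moment d U 0 = 0 by rewrite moment0 ?wt_left ?dp.
(* For the constant 1, [ip_deriv_bfam] at index 0 leaves only the left boundary term. This moment
   being nonzero, an added constant can cancel that of [U0]. *)
have nu : moment d one 1 = d.+1%:R^-1.
  have m1 : matches a h N one by [].
  have oneE j z : (one j).[z] = 1 by rewrite hornerC.
  have := ip_deriv_bfam d 0 m1; rewrite m0 sub0r mulrN opprK add0n dp eqxx.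
  have -> : (0 == p + N.-1)%N = false by lia.
  rewrite /ip big1 => [|j _]; last by rewrite /one -polyC1 derivC mul0r pint0.
  rewrite !oneE mulr0 mulr1 sub0r => e.
  apply: (mulfI dn); rewrite dp mulfV; last by rewrite -dp.
  move: e.
  by move: (_ * moment _ _ _) => m e; lra.
pose c := - (d.+1%:R * moment d U0 1).
have momE i : moment d (pw_antideriv a h c q) i = moment d U0 i + c * moment d one i.
  rewrite /moment (_ : pw_antideriv a h c q = fun j => U0 j + c *: one j).
    by rewrite ipDl ipZl; ring.
  by apply/funext => j; rewrite pw_antideriv_cst /one alg_polyC.
exists c => i; apply: moment_eq0; case: i => [|i]; first exact: m0.
elim: i => [|i IH].
  by rewrite momE nu /c mulNr mulrAC divff// mul1r subrr.
have [iN|iN] := leqP (p + N) i.+2; first by rewrite moment0// wt_right.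
have := ip_deriv_bfam d i.+1 (@pw_antideriv_matches _ a h c q N).
under eq_fun do rewrite pw_antiderivK.
rewrite dp oq//; last by lia.
rewrite IH sub0r mulrN opprK.
have -> : (i.+1 == p + N.-1)%N = false by lia.
have -> : (i.+1 + p == p)%N = false by lia.
rewrite !mulr0 subrr add0r -dp => /esym/eqP.
by rewrite mulf_eq0 (negPf dn) => /eqP.
Qed.

(** Only the first integration uses the constant of [ortho_antideriv_first]. The later ones start
    from 0 on the left, and [ortho_antideriv] gives the zero on the right; hence the end conditions
    stop below order [k]. *)
Lemma antideriv_tower q g k : (k < p)%N -> coarse g q ->
  (forall i, i != 0%N -> i != (p + N.-1)%N -> ip a h N q (bspline_fam p i) = 0) ->
  exists U, [/\ coarse g U, forall j, (U j)^`(k.+1) = q j,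
    forall s, (s <= k)%N -> matches a h N (fun j => (U j)^`(s)),
    forall s, (s < k)%N -> (U 0%N)^`(s).[x 0] = 0 /\ (U N.-1)^`(s).[x N] = 0
  & forall i, ip a h N U (bspline_fam (p - k.+1) i) = 0].
Proof.
move=> kp cq oq; elim: k kp => [|k IH] kp.
  have [|c oc] := @ortho_antideriv_first p.-1 q _ oq; first by rewrite prednK.
  exists (pw_antideriv a h c q); split=> //.
  - exact: pw_antideriv_coarse.
  - by move=> j; rewrite derivn1 pw_antiderivK.
  - by case=> // _; exact: pw_antideriv_matches.
  - by rewrite subn1.
have [U [cU Uq mU endU oU]] := IH (ltnW kp).
pose V := pw_antideriv a h 0 U.
have VU s j : (V j)^`(s.+1) = (U j)^`(s) by rewrite derivSn pw_antiderivK.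
have V0 : (V 0%N).[x 0] = 0 by rewrite pw_antideriv_left big_ord0 addr0.
have [||oV VN] := @ortho_antideriv (p - k.+2) V _ (@pw_antideriv_matches _ a h 0 U N) V0.
- by lia.
- move=> i; under eq_fun do rewrite pw_antiderivK.
  by have -> : (p - k.+2).+1 = (p - k.+1)%N by lia.
exists V; split=> //.
- exact: pw_antideriv_coarse.
- by move=> j; rewrite VU Uq.
- case=> [_|s sk]; first exact: pw_antideriv_matches.
  by under eq_fun do rewrite VU; apply: mU.
- by case=> [_|s sk]; [split|rewrite !VU; exact: endU].
Qed.

End Orthogonality.

Theorem coarse_spline_unique (R : rcfType) (a h : R) (M g p : nat)
    (N := (M * g)%N) (q : nat -> {poly R}) :
  0 < h -> (0 < M)%N -> (1 < g)%N -> (0 < p)%N -> coarse g q ->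
  (forall s, (s < p.-1)%N -> matches a h N (fun j => (q j)^`(s))) ->
  (forall j, (q j)^`(p) = 0) ->
  (forall i, i != 0%N -> i != (p + N.-1)%N ->
     ip a h N q (bspline_fam a h N p p i) = 0) ->
  forall j, (j < N)%N -> q j = 0.
Proof.
move=> h0 M0 g1 p0 cq mq qp oq.
have N0 : (0 < N)%N by rewrite muln_gt0 M0; lia.
have [U [cU Uq mU endU oU]] := antideriv_tower h0 N0 (ltac:(lia) : (p.-1 < p)%N) cq oq.
rewrite prednK// subnn in Uq oU.
pose G := pw_antideriv a h 0 U.
have GU s j : (G j)^`(s.+1) = (U j)^`(s) by rewrite derivSn pw_antiderivK.
(* Degree-0 B-splines are indicators of elements, so orthogonality to them gives [U] zero mean on
   each element. *)
have sumU n : (n <= N)%N -> \sum_(i < n) pint (mesh a h i) (mesh a h i.+1) (U i) = 0.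
  move=> nN; apply: big1 => i _.
  have := oU (p + i)%N; rewrite /ip (bigD1 (Ordinal (leq_trans (ltn_ord i) nN)))//=.
  rewrite /bspline_fam /= eqxx mulr1 big1 ?addr0// => j ji.
  have -> : (p + i == p + j)%N = false.
    by rewrite eqn_add2l eq_sym; apply/negbTE; apply: contra ji => /eqP e; apply/eqP/val_inj.
  by rewrite mulr0 pint0.
have Gl j : (j < N)%N -> (G j).[mesh a h j] = 0.
  by move=> jN; rewrite pw_antideriv_left sumU ?addr0// ltnW.
have Gr j : (j < N)%N -> (G j).[mesh a h j.+1] = 0.
  by move=> jN; rewrite pw_antideriv_right sumU ?addr0.
have G0 : forall j, (j < N)%N -> G j = 0.
  apply: (@spline_zeros_eq0 R a h h0 p g p0 g1 M) => //.
  - exact: pw_antideriv_coarse.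
  - case=> [_|s sp]; first exact: pw_antideriv_matches.
    under eq_fun do rewrite GU.
    have [sp1|ps] := ltnP s p; first by apply: mU; lia.
    (* Beyond order [p] the derivatives of [G] are those of [q], here of order at most [p - 2]. *)
    have Us j : (U j)^`(s) = (q j)^`(s - p) by rewrite -{1}(subnKC ps) derivn_add Uq.
    move=> j jN; rewrite !Us; apply: (mq (s - p)%N _ j jN); lia.
  - case=> [_|s sp]; first exact: Gl.
    by rewrite GU; have [] := endU s ltac:(lia).
  - case=> [_|s sp].
      by have := Gr N.-1; rewrite prednK//; apply.
    by rewrite GU; have [] := endU s ltac:(lia).
  - move=> j; rewrite GU -addnn derivn_add Uq.
    by rewrite qp.
by move=> j jN; rewrite -Uq -GU G0// linear0.
Qed.


(** * Lebesgue integrals *)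

Section Bridge.
Variable R : realType.
Local Notation mu := (@lebesgue_measure R).
Import numFieldNormedType.Exports.

Lemma poly_integrable (P : {poly R}) c d :
  mu.-integrable `[c, d[ (EFin \o horner P).
Proof.
have : mu.-integrable `[c, d] (EFin \o horner P).
  apply: continuous_compact_integrable; first exact: segment_compact.
  exact/continuous_subspaceT/continuous_horner.
apply: integrableS => //.
by move=> x /=; rewrite !in_itv/= => /andP[-> /ltW ->].
Qed.

Lemma poly_Rintegral (P : {poly R}) c d : c < d ->
  \int[mu]_(x in `[c, d[) P.[x] = pint c d P.
Proof.
move=> cd; rewrite (Rintegral_itv_bndo_bndc (poly_integrable P c d)).
rewrite /Rintegral (@continuous_FTC2 _ _ (horner (antideriv P)))//.
- exact/continuous_subspaceT/continuous_horner.
- split=> [x _| |]; first exact: derivable_horner.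
    by apply: cvg_at_right_filter; exact: continuous_horner.
  by apply: cvg_at_left_filter; exact: continuous_horner.
- by move=> x _; rewrite -derivE antiderivK.
Qed.

Variables (a h : R) (N : nat).
Hypotheses (h_gt0 : 0 < h).
Local Notation x := (mesh a h).

(** Half-open elements follow the convention of [bspline]; the right end of the mesh is a null set
    for integrals and returns in [represents]. *)
Definition piecewise (f : R -> R) (P : nat -> {poly R}) :=
  forall j z, (j < N)%N -> x j <= z < x j.+1 -> f z = (P j).[z].

(** Integrability is carried through the induction because splitting the integral over a union
    requires it. *)
Lemma piecewise_integral f P n : piecewise f P -> (n <= N)%N ->
  mu.-integrable `[x 0, x n[ (EFin \o f) /\
  \int[mu]_(z in `[x 0, x n[) f z = \sum_(j < n) pint (x j) (x j.+1) (P j).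
Proof.
move=> fP; elim: n => [|n IH] nN.
  have -> : `[x 0, x 0[%classic = set0 :> set R by rewrite set_itvco0.
  by rewrite Rintegral_set0 big_ord0; split=> //; exact: integrable_set0.
have [int0 e0] := IH (ltnW nN).
have x0n : x 0 <= x n by exact: mesh_le.
have xn1 : x n < x n.+1 by exact: mesh_lt.
have fe : {in `[x n, x n.+1[%classic, horner (P n) =1 f}.
  by move=> z /set_mem/=; rewrite in_itv/= => zn; rewrite (fP n).
have int1 : mu.-integrable `[x n, x n.+1[ (EFin \o f).
  apply: eq_integrable (poly_integrable (P n) (x n) (x n.+1)) => //.
  by move=> z zn /=; rewrite fe.
have eU : `[x 0, x n.+1[%classic = `[x 0, x n[ `|` `[x n, x n.+1[ :> set R.
  by apply: itv_bndbnd_setU; rewrite bnd_simp// ltW.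
have dU : [disjoint `[x 0, x n[ & `[x n, x n.+1[].
  apply/disj_setPS => z /=; rewrite !in_itv/= => -[/andP[_ z1] /andP[z2 _]].
  by have := lt_le_trans z1 z2; rewrite ltxx.
have intU : mu.-integrable (`[x 0, x n[ `|` `[x n, x n.+1[) (EFin \o f).
  have /integrableP[m0 l0] := int0; have /integrableP[m1 l1] := int1.
  apply/integrableP; split; first exact/measurable_funU.
  rewrite ge0_integral_setU//; first exact: lte_add_pinfty.
  apply/measurable_funU => //; split; apply: measurable_int.
    exact: integrable_abse int0.
  exact: integrable_abse int1.
rewrite eU; split=> //; rewrite Rintegral_setU//.
by rewrite e0 big_ord_recr /= -poly_Rintegral// (eq_Rintegral mu fe).
Qed.

Lemma L2ip_piecewise u v P Q : piecewise u P -> piecewise v Q ->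
  L2ip (x 0) (x N) u v = ip a h N P Q.
Proof.
move=> uP vQ.
have uvP : piecewise (fun z => u z * v z) (fun j => P j * Q j).
  by move=> j z jN zj; rewrite hornerM (uP j) ?(vQ j).
have [int e] := piecewise_integral uvP (leqnn N).
by rewrite /L2ip -(Rintegral_itv_bndo_bndc int) e.
Qed.

End Bridge.

(** * Positivity and the Cauchy--Schwarz inequality *)

Section InnerProduct.
Variables (R : rcfType) (a h : R) (N : nat).
Hypothesis h_gt0 : 0 < h.
Implicit Types F G : nat -> {poly R}.
Local Notation ip := (ip a h N).

Lemma ip_eq F F' G : (forall j, (j < N)%N -> F j = F' j) -> ip F G = ip F' G.
Proof. by move=> FF; rewrite /ip; apply: eq_bigr => j _; rewrite FF. Qed.

Lemma ip_suml n (c : 'I_n -> R) (Q : 'I_n -> nat -> {poly R}) G :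
  ip (fun j => \sum_i c i *: Q i j) G = \sum_i c i * ip (Q i) G.
Proof.
rewrite /ip; under [RHS]eq_bigr do rewrite mulr_sumr.
rewrite exchange_big /=; apply: eq_bigr => j _.
rewrite mulr_suml (big_morph _ (pintD _ _) (pint0 _ _)).
by apply: eq_bigr => i _; rewrite -scalerAl pintZ.
Qed.

Lemma ip_ge0 F : 0 <= ip F F.
Proof.
by apply: sumr_ge0 => j _; apply: pint_sqr_ge0; apply: mesh_le.
Qed.

Lemma ip_eq0 F : ip F F = 0 -> forall j, (j < N)%N -> F j = 0.
Proof.
move=> /eqP; rewrite psumr_eq0 => [/allP F0 j jN|j _]; last first.
  by apply: pint_sqr_ge0; apply: mesh_le.
have := F0 (Ordinal jN); rewrite mem_index_enum => /(_ isT)/= /eqP.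
by apply: pint_sqr_eq0; apply: mesh_lt.
Qed.

Lemma ip_CauchySchwarz F G : `|ip F G| <= Num.sqrt (ip F F) * Num.sqrt (ip G G).
Proof.
have quad s r : 0 <= s ^+ 2 * ip F F + s * r * ip F G *+ 2 + r ^+ 2 * ip G G.
  pose H j : {poly R} := s *: F j + r *: G j.
  have e U : ip H U = s * ip F U + r * ip G U by rewrite /H ipDl !ipZl.
  have := ip_ge0 H; rewrite e (ipC _ _ _ F H) (ipC _ _ _ G H) !e (ipC _ _ _ G F); lra.
have F0 := ip_ge0 F; have G0 := ip_ge0 G.
rewrite -sqrtrM// -sqrtr_sqr ler_wsqrtr//.
move: (ip F F) (ip F G) (ip G G) quad F0 G0 => x y z quad x0 z0.
have [z_gt0|] := ltP 0 z.
  have := quad z (- y); have -> : z ^+ 2 * x + z * - y * y *+ 2 + (- y) ^+ 2 * z =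
    z * (x * z - y ^+ 2) by ring.
  by rewrite pmulr_rge0// subr_ge0.
move=> zle; have {zle z0}z0 : z = 0 by lra.
rewrite z0 mulr0; have [->|y0] := eqVneq y 0; first by rewrite expr0n.
(* With [z = 0] and [y] nonzero, this choice gives the form the negative value [- x - 2]. *)
have := quad 1 (- (x + 1) / y); rewrite z0 mulr0 addr0 expr1n !mul1r divfK//.
by rewrite mulr2n; lra.
Qed.

End InnerProduct.

(** * Functions given by polynomial pieces *)

Section Represents.
Variable R : realType.
Implicit Types (a h : R) (N : nat) (f : R -> R) (P : nat -> {poly R}).

(** The right end and the exterior are recorded so that the pieces determine [f] on the whole line:
    the zero function removed from the spaces is a function on [R]. *)
Definition represents a h N f P :=
  [/\ piecewise a h N f P, f (mesh a h N) = (P N.-1).[mesh a h N]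
    & forall z, (z < mesh a h 0) || (mesh a h N < z) -> f z = 0].

Lemma represents_sum a h N n (c : 'I_n -> R) (F : 'I_n -> R -> R)
    (P : 'I_n -> nat -> {poly R}) :
  (forall i, represents a h N (F i) (P i)) ->
  represents a h N (fun z => \sum_i c i * F i z)
    (fun j => \sum_i c i *: P i j).
Proof.
move=> FP; split=> [j z jN zj||z zout].
- rewrite horner_sum; apply: eq_bigr => i _; rewrite hornerZ.
  by have [e _ _] := FP i; rewrite (e _ _ jN zj).
- rewrite horner_sum; apply: eq_bigr => i _; rewrite hornerZ.
  by have [_ -> _] := FP i.
- by apply: big1 => i _; have [_ _ ->] := FP i; rewrite ?mulr0.
Qed.

Lemma mesh_cover a h N z : 0 < h -> mesh a h 0 <= z < mesh a h N ->
  exists2 j, (j < N)%N & mesh a h j <= z < mesh a h j.+1.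
Proof.
move=> h0 /andP[z0]; elim: N => [|N IH] zN; first by have := le_lt_trans z0 zN; rewrite ltxx.
have [/IH[j jN zj]|Nz] := ltP z (mesh a h N); last by exists N; rewrite ?Nz.
by exists j => //; exact: leqW.
Qed.

Lemma represents_zero a h N f P : 0 < h -> (0 < N)%N -> represents a h N f P ->
  (forall j, (j < N)%N -> P j = 0) -> f = fun=> 0.
Proof.
move=> h0 N0 [fP fN fout] P0; apply/funext => z.
have [zl|zl] := ltP z (mesh a h 0); first by rewrite fout ?zl.
have [zr|] := ltP z (mesh a h N).
  have [j jN zj] := mesh_cover h0 (introT andP (conj zl zr)).
  by rewrite (fP _ _ jN zj) P0// horner0.
rewrite le_eqVlt => /predU1P[<-|zr]; last by rewrite fout ?zr ?orbT.
by rewrite fN P0 ?horner0// prednK.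
Qed.

(** Moves functions on the coarse mesh to the fine one, where they are paired with fine splines. *)
Lemma represents_refine a h M g f P : 0 < h -> (0 < g)%N -> (0 < M)%N ->
  represents a (g%:R * h) M f P ->
  represents a h (M * g) f (fun j => P (j %/ g)%N).
Proof.
move=> h0 g0 M0; have meshE J : mesh a (g%:R * h) J = mesh a h (J * g).
  by rewrite /mesh natrM mulrA.
move=> [fP fN fout]; split=> [j z jN /andP[z1 z2]||z zout].
- apply: fP; first by rewrite ltn_divLR.
  rewrite !meshE (le_trans _ z1) ?(lt_le_trans z2)//; apply: mesh_le => //.
    by rewrite -ltn_divLR.
  exact: leq_divM.
- rewrite -meshE fN.
  have -> : ((M * g).-1 = M.-1 * g + g.-1)%N by rewrite -{1}(prednK M0) mulSn; lia.
  by rewrite divnMDl// divn_small ?addn0// prednK.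
- by apply: fout; rewrite !meshE mul0n.
Qed.

End Represents.

Section BsplineRepresents.
Variables (R : realType) (a h : R) (N p : nat).
Hypotheses (h_gt0 : 0 < h) (N_gt0 : (0 < N)%N).
Local Notation x := (mesh a h).
Local Notation t := (knots a h N p).

Lemma mesh0 : x 0 = a.
Proof. by rewrite /mesh mul0r addr0. Qed.

Lemma open_knotsE : open_knots a h N p = t.
Proof.
apply/funext => i; rewrite /open_knots; case: leqP => [ip|pi].
  by rewrite knots_left// mesh0.
case: leqP => [Npi|iNp]; first by rewrite knots_right// addnC.
by rewrite /knots; congr mesh; lia.
Qed.

Lemma knots_ge i : x 0 <= t i.
Proof. exact: mesh_le. Qed.

Lemma knots_le i : t i <= x N.
Proof. by apply: mesh_le => //; exact: geq_minr. Qed.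

Lemma bspline_represents d i :
  represents a h N (bspline t (x N) d i) (bspline_fam a h N p d i).
Proof.
elim: d i => [|d IH] i.
  split=> [j z jN /andP[z1 z2]||z zout]; rewrite /= /bspline_fam/=.
  - rewrite hornerC.
    have -> : (z == x N) = false.
      by rewrite lt_eqF// (lt_le_trans z2)// mesh_le.
    rewrite !andbF orbF.
    have [->|ne] := eqVneq i (p + j)%N.
      by rewrite -addnS !knots_mid ?(ltnW jN)// z1 z2.
    case: ifP => // /andP[t1 t2]; exfalso.
    have [ij|ij] : (i.+1 <= p + j)%N \/ (p + j.+1 <= i)%N by lia.
      have := knots_mono a N p h_gt0 ij; rewrite knots_mid ?(ltnW jN)// => tx.
      by have := lt_le_trans t2 (le_trans tx z1); rewrite ltxx.
    have := knots_mono a N p h_gt0 ij; rewrite knots_mid// => tx.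
    by have := le_lt_trans (le_trans tx t1) z2; rewrite ltxx.
  (* At the right end only the closing convention of degree 0 can apply, and it selects the last
     nonempty span [p + N.-1]. *)
  - have -> : (x N < t i.+1) = false by rewrite ltNge knots_le.
    rewrite hornerC andbF/= eqxx andbT.
    have [->|ne] := eqVneq i (p + N.-1)%N.
      by rewrite -addnS prednK// !knots_mid// ?leq_pred// eqxx mesh_lt// prednK.
    case: ifP => // /andP[t1 /eqP t2]; exfalso; move: t1; rewrite t2.
    have [ij|ij] : (p + N <= i)%N \/ (i.+1 <= p + N.-1)%N by lia.
      by rewrite knots_right// ltxx.
    have := knots_mono a N p h_gt0 ij; rewrite t2 knots_mid ?leq_pred//.
    by rewrite leNgt mesh_lt// prednK.
  - have -> : (z == x N) = false.
      apply/negP => /eqP zN; move: zout; rewrite zN ltxx orbF ltNge mesh_le//.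
    rewrite !andbF orbF; case: ifP => // /andP[t1 t2]; exfalso; move: zout.
    by rewrite !ltNge (le_trans (knots_ge i) t1) (ltW (lt_le_trans t2 (knots_le _))).
have rec z : bspline t (x N) d.+1 i z =
    wt t d i * ((z - t i) * bspline t (x N) d i z)
    + wt t d i.+1 * ((t (i.+1 + d.+1)%N - z) * bspline t (x N) d i.+1 z).
  rewrite /= /wt addSnnS; ring.
split=> [j z jN zj||z zout]; rewrite rec.
- rewrite /bspline_fam bpieceS !(hornerD, hornerN, hornerM, hornerC, hornerX).
  by have [e _ _] := IH i; have [e' _ _] := IH i.+1; rewrite (e _ _ jN zj) (e' _ _ jN zj).
- rewrite /bspline_fam bpieceS !(hornerD, hornerN, hornerM, hornerC, hornerX).
  by have [_ -> _] := IH i; have [_ -> _] := IH i.+1.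
- have [_ _ ->//] := IH i; have [_ _ ->//] := IH i.+1.
  by rewrite !mulr0 addr0.
Qed.

End BsplineRepresents.

(** * The inf-sup constant *)

Section DiscreteInfSup.
Variables (R : rcfType) (a h : R) (N : nat).
Hypothesis h_gt0 : 0 < h.
Local Notation ip := (ip a h N).
Local Notation nrm P := (Num.sqrt (ip P P)).

(** If every pairing were small relative to the norms, coefficients rebuilt linearly from the
    pairings would give [comb c] a norm smaller than its own. *)
Lemma discrete_infsup n K (Q : 'I_n -> nat -> {poly R})
    (V : 'I_K -> nat -> {poly R})
    (comb := fun (c : 'rV[R]_n) j => \sum_i c 0 i *: Q i j) :
  (forall c, (forall k, ip (V k) (comb c) = 0) ->
     forall j, (j < N)%N -> comb c j = 0) ->
  exists2 alpha, 0 < alpha & forall c, 0 < ip (comb c) (comb c) ->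
    exists k, alpha * (nrm (V k) * nrm (comb c)) < `|ip (V k) (comb c)|.
Proof.
move=> uniqQ; pose B := \matrix_(i < n, k < K) ip (V k) (Q i).
have ipB c k : ip (V k) (comb c) = (c *m B) 0 k.
  by rewrite ipC ip_suml mxE; apply: eq_bigr => i _; rewrite mxE ipC.
(* A pseudo-inverse suits a matrix of any shape and rank: [c'] has the same pairings as [c], so
   [uniqQ] gives both the same combination. *)
pose P := pinvmx B.
pose D k := \sum_i `|P k i| * nrm (Q i).
pose E := \sum_k D k * nrm (V k).
have D0 k : 0 <= D k by apply: sumr_ge0 => i _; rewrite mulr_ge0 ?sqrtr_ge0.
have E0 : 0 <= E by apply: sumr_ge0 => k _; rewrite mulr_ge0 ?sqrtr_ge0.
exists (E + 1)^-1; first by rewrite invr_gt0; lra.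
move=> c q0; set q := comb c.
pose y := c *m B; pose c' := y *m P.
have c'B : c' *m B = c *m B by rewrite mulmxKpV// submxMl.
have combB j : comb (c - c') j = comb c j - comb c' j.
  rewrite /comb -sumrB; apply: eq_bigr => i _.
  by rewrite !mxE scalerBl.
have qE j : (j < N)%N -> q j = comb c' j.
  move=> jN; apply/eqP; rewrite -subr_eq0 -combB; apply/eqP.
  by apply: uniqQ jN => k; rewrite ipB mulmxBl c'B subrr mxE.
apply: contrapT => /forallNP small.
have {}small k : `|y 0 k| <= (E + 1)^-1 * (nrm (V k) * nrm q).
  by rewrite leNgt -ipB; apply/negP; exact: small.
have nq : 0 < nrm q by rewrite sqrtr_gt0.
have c'le i : `|c' 0 i| <= \sum_k `|y 0 k| * `|P k i|.
  by rewrite mxE (le_trans (ler_norm_sum _ _ _))// ler_sum// => k _; rewrite normrM.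
(* Contradictory since [E / (E + 1) < 1]; the added 1 also covers [E = 0]. *)
have : nrm q * nrm q <= (E + 1)^-1 * E * (nrm q * nrm q).
  rewrite -expr2 sqr_sqrtr ?ip_ge0// {1}(ip_eq _ _ _ qE) ip_suml.
  apply: (@le_trans _ _ (\sum_i \sum_k `|y 0 k| * `|P k i| * (nrm (Q i) * nrm q))).
    apply: ler_sum => i _; rewrite -mulr_suml.
    apply: le_trans (ler_norm _) _; rewrite normrM.
    by apply: ler_pM => //; exact: ip_CauchySchwarz.
  rewrite exchange_big /= -[X in _ * X]sqr_sqrtr ?ip_ge0// expr2 -/q.
  rewrite /E mulrAC mulrA mulr_sumr; apply: ler_sum => k _.
  under eq_bigr do rewrite -mulrA [_ * (nrm _ * _)]mulrA.
  rewrite -mulr_sumr -mulr_suml -/(D k).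
  apply: le_trans (ler_wpM2r _ (small k)) _; first by rewrite mulr_ge0// ltW.
  by rewrite le_eqVlt; apply/orP; left; apply/eqP; ring.
rewrite ler_pMl ?mulr_gt0// mulrC ler_pdivlMr ?mul1r; lra.
Qed.

End DiscreteInfSup.

(** * Coarse splines seen on the fine mesh *)

Section CoarseSplines.
Variables (R : rcfType).
Implicit Types (a h : R) (P : nat -> {poly R}).

Lemma coarse_refine g P : (0 < g)%N -> coarse g (fun j => P (j %/ g)%N).
Proof. by move=> g0 j gj; rewrite divnS// (negPf gj). Qed.

Lemma matches_refine a h M g P : (0 < g)%N -> matches a (g%:R * h) M P ->
  matches a h (M * g) (fun j => P (j %/ g)%N).
Proof.
move=> g0 mP j jN; have [gj|gj] := boolP (g %| j.+1)%N; last first.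
  by rewrite (coarse_refine P g0 gj).
have e : (j.+1 %/ g = (j %/ g).+1)%N by rewrite divnS// gj.
have me : mesh a h j.+1 = mesh a (g%:R * h) (j %/ g).+1.
  by rewrite /mesh -e mulrA -natrM divnK.
by rewrite me e mP// -e ltn_divLR.
Qed.

Lemma derivn_sum_scale n (c : 'I_n -> R) (F : 'I_n -> {poly R}) s :
  (\sum_i c i *: F i)^`(s) = \sum_i c i *: (F i)^`(s).
Proof. by rewrite raddf_sum; under eq_bigr do rewrite /= derivnZ. Qed.

Lemma size_bpiece (t : nat -> R) d i m : (size (bpiece t d i m) <= d.+1)%N.
Proof.
elim: d i => [|d IH] i; first exact: size_polyC_leq1.
have sz (P Q : {poly R}) (c : R) : (size Q <= 2)%N -> (size P <= d.+1)%N ->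
    (size (c%:P * (Q * P))%R <= d.+2)%N.
  move=> sQ sP; rewrite mul_polyC (leq_trans (size_scale_leq _ _))//.
  by rewrite (leq_trans (size_polyMleq _ _))//; lia.
have szX (c : R) : (size ('X - c%:P)%R <= 2)%N by rewrite size_XsubC.
have szX' (c : R) : (size (c%:P - 'X)%R <= 2)%N by rewrite -opprB size_polyN.
by rewrite bpieceS (leq_trans (size_polyD _ _))// geq_max !sz.
Qed.

Lemma derivn_eq0 (P : {poly R}) n : (size P <= n)%N -> P^`(n) = 0.
Proof.
by move=> sP; apply/polyP => i; rewrite coef_derivn coef0 nth_default ?mul0rn// (leq_trans sP)// leq_addr.
Qed.

Lemma coarse_span_unique a h M g p (N := (M * g)%N) n (c : 'I_n -> R)
    (q := fun j => \sum_i c i *: bspline_fam a (g%:R * h) M p.-1 p.-1 i (j %/ g)%N) :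
  0 < h -> (0 < M)%N -> (1 < g)%N -> (0 < p)%N ->
  (forall k, (k < (N + p).-2)%N -> ip a h N (bspline_fam a h N p p k.+1) q = 0) ->
  forall j, (j < N)%N -> q j = 0.
Proof.
move=> h0 M0 g1 p0 oq; have g0 : (0 < g)%N by exact: ltnW.
have H0 : 0 < g%:R * h by rewrite mulr_gt0// ltr0n.
apply: (coarse_spline_unique h0 M0 g1 p0).
- move=> j gj; apply: eq_bigr => i _.
  by rewrite (coarse_refine (bspline_fam a (g%:R * h) M p.-1 p.-1 i) g0 gj).
- move=> s sp j jN; rewrite /q !derivn_sum_scale !horner_sum.
  apply: eq_bigr => i _; rewrite !hornerZ; congr (_ * _).
  exact: (matches_refine g0 (@bspline_fam_derivn_match R a _ M p.-1 H0 p.-1 i s sp)).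
- move=> j; rewrite derivn_sum_scale big1// => i _.
  by rewrite derivn_eq0 ?scaler0// (leq_trans (size_bpiece _ _ _ _))// prednK.
(* Indices past [N + p - 1] give B-splines of zero weight. *)
- move=> [//|k] _ kN; rewrite ipC; have [kle|kge] := ltnP k (N + p).-2.
    exact: oq.
  rewrite ipC ip_bfam_wt0//; apply: wt_right; rewrite -/N in kN *; lia.
Qed.

End CoarseSplines.

(** * Spline spaces and their L2 norms *)

Section SplineSpaces.
Variables (R : realType) (a h : R) (N : nat).
Hypotheses (h_gt0 : 0 < h) (N_gt0 : (0 < N)%N).
Let b := a + N%:R * h.

Lemma L2ip_represents u v P Q : represents a h N u P -> represents a h N v Q ->
  L2ip a b u v = ip a h N P Q.
Proof. by move=> [uP _ _] [vQ _ _]; rewrite -(L2ip_piecewise h_gt0 uP vQ) mesh0. Qed.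

Lemma L2norm_represents u P : represents a h N u P ->
  L2norm a b u = Num.sqrt (ip a h N P P).
Proof. by move=> uP; rewrite /L2norm (L2ip_represents uP uP). Qed.

(** Bounds the quotients from above, so that their [sup] dominates each of them. *)
Lemma L2_CauchySchwarz u v P Q : represents a h N u P -> represents a h N v Q ->
  L2ip a b u v / (L2norm a b u * L2norm a b v) <= 1.
Proof.
move=> uP vQ; rewrite (L2ip_represents uP vQ) (L2norm_represents uP).
rewrite (L2norm_represents vQ); set n := (X in _ / X).
have : 0 <= n by rewrite mulr_ge0 ?sqrtr_ge0.
rewrite le_eqVlt => /predU1P[<-|n0]; first by rewrite invr0 mulr0.
rewrite ler_pdivrMr// mul1r; apply: le_trans (ler_norm _) _.
exact: ip_CauchySchwarz.
Qed.

Lemma spline_represents p (c : nat -> R) :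
  represents a h N
    (fun z => \sum_(i < N + p) c i * bspline (open_knots a h N p) b p i z)
    (fun j => \sum_(i < N + p) c i *: bspline_fam a h N p p i j).
Proof.
apply: (@represents_sum R a h N _ (fun i => c i)) => i.
by rewrite open_knotsE//; exact: bspline_represents.
Qed.

(** Among the B-splines of degree [p] only the first and the last are nonzero at an end of the
    interval. *)
Lemma bspline_Vh p k s : (k < (N + p).-2)%N ->
  Vh a h N p (fun z => s * bspline (open_knots a h N p) b p k.+1 z).
Proof.
move=> kK; have kN : (k.+1 < N + p)%N by lia.
have [Bp Br _] := @bspline_represents R a h N p h_gt0 N_gt0 p k.+1.
rewrite -open_knotsE// in Bp Br; split; last split.
- exists (fun i => if i == k.+1 then s else 0); apply/funext => z.
  rewrite (bigD1 (Ordinal kN))//= eqxx big1 ?addr0// => i ik.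
  case: eqP => [e|_]; last by rewrite mul0r.
  by case/eqP: ik; apply: val_inj.
- have a1 : mesh a h 0 < mesh a h 1 by exact: mesh_lt.
  have Ba : (bspline_fam a h N p p k.+1 0).[mesh a h 0] = (k.+1 + p == p)%N%:R.
    exact: bspline_fam_left.
  rewrite mesh0 in a1 Ba; rewrite (Bp 0%N) ?mesh0 ?lexx// Ba.
  have -> : (k.+1 + p == p)%N = false by lia.
  by rewrite mulr0.
- rewrite -/(mesh a h N) Br bspline_fam_right//.
  have -> : (k.+1 == p + N.-1)%N = false by lia.
  by rewrite mulr0.
Qed.

End SplineSpaces.

Theorem mainTheorem5 (R : realType) (a b : R) (p L N : nat) (h : R) :
  a < b -> (2 <= p)%N -> (1 <= L)%N -> (0 < N)%N ->
  (2 ^ L %| N)%N -> h = (b - a) / N%:R -> 0 < h ->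
  exists alpha : R, 0 < alpha /\
    alpha <= inf [set (sup [set L2ip a b v q / (L2norm a b v * L2norm a b q)
                           | v in Vh a h N p `\ (fun _ => 0)])
                 | q in QL a h N p L `\ (fun _ => 0)].
Proof.
move=> ab p2 L1 N0 gN hE h0.
have -> : b = a + N%:R * h by rewrite hE mulrC divfK ?pnatr_eq0 -?lt0n// addrC subrK.
move=> {ab hE b}.
rewrite /QL; set g := (2 ^ L)%N in gN *; set M := (N %/ g)%N.
have g1 : (1 < g)%N by rewrite -(expn0 2) ltn_exp2l.
have g0 : (0 < g)%N by exact: ltnW.
have NE : N = (M * g)%N by rewrite divnK.
have M0 : (0 < M)%N by move: N0; rewrite NE muln_gt0 => /andP[].
have H0 : 0 < g%:R * h by rewrite mulr_gt0// ltr0n.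
have p0 : (0 < p)%N by exact: ltnW.
have qrep (c : nat -> R) : represents a h N
    (fun z => \sum_(i < M + p.-1) c i *
       bspline (open_knots a (g%:R * h) M p.-1) (a + M%:R * (g%:R * h)) p.-1 i z)
    (fun j => \sum_(i < M + p.-1) c i *: bspline_fam a (g%:R * h) M p.-1 p.-1 i (j %/ g)%N).
  rewrite [in represents _ _ N]NE.
  exact: (represents_refine h0 g0 M0 (spline_represents a H0 M0 p.-1 c)).
pose Q (i : 'I_(M + p.-1)) j := bspline_fam a (g%:R * h) M p.-1 p.-1 i (j %/ g)%N.
pose V (k : 'I_(N + p).-2) := bspline_fam a h N p p k.+1.
have [|alpha alpha0 alphaP] := @discrete_infsup R a h N h0 _ _ Q V.
  move=> c oc j jN.
  have := @coarse_span_unique R a h M g p _ (fun i => c 0 i) h0 M0 g1 p0.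
  rewrite -NE => uniq; apply: (fun H => uniq H j jN) => k kK.
  exact: (oc (Ordinal kK)).
exists alpha; split=> //; apply: lb_le_inf.
  (* [lb_le_inf] asks for a nonempty set: the first coarse B-spline equals 1 at the left end, hence
     is a nonzero element of [QL]. *)
  pose c (i : nat) : R := (i == 0%N)%:R.
  pose q z := \sum_(i < M + p.-1) c i *
     bspline (open_knots a (g%:R * h) M p.-1) (a + M%:R * (g%:R * h)) p.-1 i z.
  eexists; exists q; last by reflexivity.
  split; first by exists c.
  have i0 : (0 < M + p.-1)%N by rewrite addn_gt0 M0.
  have [qP _ _] := spline_represents a H0 M0 p.-1 c.
  move=> /(congr1 (fun f => f (mesh a (g%:R * h) 0))); rewrite /q.
  rewrite (qP 0%N) ?lexx ?mesh_lt// (bigD1 (Ordinal i0))//= big1 => [|i ine]; last first.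
    by rewrite /c (_ : (i == 0 :> nat) = false) ?scale0r//; apply/negbTE.
  rewrite addr0 scale1r bspline_fam_left// add0n eqxx => /eqP.
  by rewrite oner_eq0.
move=> _ [q [[c qE] q0] <-].
have {}qrep := qrep c; rewrite -qE in qrep.
pose cr : 'rV[R]_(M + p.-1) := \row_i c i.
have combE : (fun j => \sum_i cr 0 i *: Q i j) =
    (fun j => \sum_(i < M + p.-1) c i *: bspline_fam a (g%:R * h) M p.-1 p.-1 i (j %/ g)%N).
  by apply/funext => j; apply: eq_bigr => i _; rewrite mxE.
rewrite -combE in qrep; set qf := fun j => _ in qrep.
have q_gt0 : 0 < ip a h N qf qf.
  rewrite lt_def ip_ge0// andbT; apply/eqP => /(ip_eq0 h0) z.
  exact/q0/(represents_zero h0 N0 qrep).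
have [k] := alphaP cr q_gt0; rewrite -/qf; set y := ip _ _ _ (V k) qf => ky.
(* The sign makes the pairing of [v] with [q] equal to the absolute value of [y]. *)
pose s : R := Num.sg y.
pose v z := s * bspline (open_knots a h N p) (a + N%:R * h) p k.+1 z.
have Vrep : represents a h N (bspline (open_knots a h N p) (a + N%:R * h) p k.+1) (V k).
  by rewrite open_knotsE//; exact: bspline_represents.
have nV : 0 < Num.sqrt (ip a h N (V k) (V k)).
  rewrite lt_def sqrtr_ge0 andbT; apply/eqP => V0.
  by have := ip_CauchySchwarz a N h0 (V k) qf; move: ky; rewrite V0 !mul0r mulr0; lra.
have ngt := mulr_gt0 nV (etrans (sqrtr_gt0 _) q_gt0).
have y0 : y != 0.
  apply/eqP => y0; move: ky; rewrite y0 normr0 => /(lt_trans (mulr_gt0 alpha0 ngt)).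
  by rewrite ltxx.
have vrep : represents a h N v (fun j => s *: V k j).
  have := @represents_sum R a h N 1 (fun=> s) _ _ (fun=> Vrep).
  by under eq_fun do rewrite big_ord1; under [X in represents _ _ _ _ X]eq_fun do rewrite big_ord1.
have vq : L2ip a (a + N%:R * h) v q = `|y|.
  by rewrite (L2ip_represents h0 vrep qrep) ipZl -/y [RHS]normrEsg.
have nv : L2norm a (a + N%:R * h) v = Num.sqrt (ip a h N (V k) (V k)).
  rewrite (L2norm_represents h0 vrep) ipZl ipC ipZl mulrA -expr2.
  by rewrite sqr_sg y0 mul1r.
apply: (@le_trans _ _ (L2ip a (a + N%:R * h) v q /
    (L2norm a (a + N%:R * h) v * L2norm a (a + N%:R * h) q))).
  by rewrite vq nv (L2norm_represents h0 qrep) ler_pdivlMr// ltW.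
apply: ub_le_sup.
  exists 1 => _ [w [[[cw ->] _] _] <-].
  exact: (L2_CauchySchwarz h0 (spline_represents a h0 N0 p cw) qrep).
exists v => //; split; first exact: bspline_Vh.
(* If [v] were zero, so would be its pairing with [q], against [y0]. *)
move=> v0; have z0 : represents a h N (fun=> 0) (fun=> 0).
  by split=> [j z _ _||//]; rewrite horner0.
move: vq; rewrite v0 (L2ip_represents h0 z0 qrep) /ip big1 => [/esym/eqP|j _].
  by rewrite normr_eq0 (negPf y0).
by rewrite mul0r pint0.
Qed.
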